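(* Let $\mathcal{X}=R^2L$, $\mathcal{Y}=LRL^2$ and $\mathcal{S}[k]=\mathcal{X}^k\mathcal{Y}$. Then the border-collision normal form with $$\tau_L=-\sqrt2,\qquad\delta_L=1,\qquad\tau_R=1-\sqrt2,\qquad\delta_R=1,\qquad\mu=1,$$ has a unique $\mathcal{S}[k]$-cycle for all $k\ge1$, that is admissible and stable for all $k\ge8$, and is virtual otherwise.
   Context: For real $\tau_L,\delta_L,\tau_R,\delta_R,\mu$ set $A_J=\begin{bmatrix}\tau_J&1\\ -\delta_J&0\end{bmatrix}$ and $f^J(x,y)=A_J\begin{bmatrix}x\\ y\end{bmatrix}+\begin{bmatrix}\mu\\ 0\end{bmatrix}$ for $J\in\{L,R\}$. The border-collision normal form is the continuous map of $\mathbb{R}^2$ equal to $f^L$ for $x\le0$ and $f^R$ for $x\ge0$; the switching manifold is $x=0$. For a word $\mathcal{S}=\mathcal{S}_0\cdots\mathcal{S}_{n-1}$ on $\{L,R\}$ (powers and juxtaposition denote concatenation, so $\mathcal{X}=RRL$, $\mathcal{Y}=LRLL$, and $\mathcal{X}^k\mathcal{Y}$ is $k$ copies of $\mathcal{X}$ followed by $\mathcal{Y}$), put $f^{\mathcal{S}}=f^{\mathcal{S}_{n-1}}\circ\cdots\circ f^{\mathcal{S}_0}$, an affine map with matrix part $M_{\mathcal{S}}=A_{\mathcal{S}_{n-1}}\cdots A_{\mathcal{S}_0}$. An $\mathcal{S}$-cycle consists of points $(x_i^{\mathcal{S}},y_i^{\mathcal{S}})$, $i=0,\dots,n-1$, with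 $(x_0^{\mathcal{S}},y_0^{\mathcal{S}})$ a fixed point of $f^{\mathcal{S}}$ and $(x_{i+1}^{\mathcal{S}},y_{i+1}^{\mathcal{S}})=f^{\mathcal{S}_i}(x_i^{\mathcal{S}},y_i^{\mathcal{S}})$. It is unique if and only if $1$ is not an eigenvalue of $M_{\mathcal{S}}$. It is admissible if $x_i^{\mathcal{S}}\le0$ whenever $\mathcal{S}_i=L$ and $x_i^{\mathcal{S}}\ge0$ whenever $\mathcal{S}_i=R$; it is virtual if it is not admissible. An admissible $\mathcal{S}$-cycle with no points on the switching manifold ($x_i^{\mathcal{S}}\ne0$ for all $i$) is stable if both eigenvalues of $M_{\mathcal{S}}$ have modulus $\le1$. *)

(* Defs.v *)
From mathcomp Require Import all_boot all_order all_algebra.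
From mathcomp Require Import complex reals.

Set Implicit Arguments.
Unset Strict Implicit.
Unset Printing Implicit Defensive.

Import Order.TTheory GRing.Theory Num.Theory.
Local Open Scope ring_scope.
Local Open Scope complex_scope.

Inductive symbol := symL | symR.

Definition word := seq symbol.

Definition word_pow (X : word) (k : nat) : word := flatten (nseq k X).

Record bcnf_params (R : realType) := BcnfParams {
  tauL : R; deltaL : R; tauR : R; deltaR : R; mu : R
}.

Section BCNF.
Variables (R : realType) (xi : bcnf_params R).

(* A point (x, y) of the plane is a column vector: x is entry 0, y is entry 1. *)
Definition xcoord (p : 'cV[R]_2) : R := p 0 0.

Definition compan (tau delta : R) : 'M[R]_2 :=
  \matrix_(i < 2, j < 2)
    (if i == 0 then (if j == 0 then tau else 1)
               else (if j == 0 then - delta else 0)).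

Definition Amx (J : symbol) : 'M[R]_2 :=
  match J with
  | symL => compan (tauL xi) (deltaL xi)
  | symR => compan (tauR xi) (deltaR xi)
  end.

Definition bvec : 'cV[R]_2 := \col_(i < 2) (if i == 0 then mu xi else 0).

Definition piece (J : symbol) (p : 'cV[R]_2) : 'cV[R]_2 := Amx J *m p + bvec.

Definition bcnf (p : 'cV[R]_2) : 'cV[R]_2 :=
  if xcoord p <= 0 then piece symL p else piece symR p.

Definition on_side (J : symbol) (p : 'cV[R]_2) : bool :=
  match J with
  | symL => xcoord p <= 0
  | symR => 0 <= xcoord p
  end.

(* The two pieces agree on the switching manifold, so the choice made there in
   [bcnf] is immaterial. *)
Lemma bcnf_piece (J : symbol) (p : 'cV[R]_2) :
  on_side J p -> bcnf p = piece J p.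
Proof.
rewrite /on_side /bcnf; case: J => [-> //|p_ge0].
case: ifP => // p_le0.
have p0 : p 0 0 = 0 by apply/eqP; rewrite eq_le p_le0 p_ge0.
rewrite /piece; congr (_ + _); apply/matrixP => i j.
by rewrite (ord1 j) !mxE !big_ord_recl !big_ord0 !mxE /= p0 !mulr0.
Qed.

(* [foldl] applies the first letter of the word first:
   f^S = f^{S_{n-1}} o ... o f^{S_0} and M_S = A_{S_{n-1}} ... A_{S_0}. *)
Definition word_map (S : word) (p : 'cV[R]_2) : 'cV[R]_2 :=
  foldl (fun q J => piece J q) p S.

Definition word_mx (S : word) : 'M[R]_2 :=
  foldl (fun M J => Amx J *m M) 1%:M S.

(* [s] lists the points with indices 0, ..., n-1, where n = size S.  The default
   letter [symL] is never used, as the index is within bounds. *)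
Definition is_cycle (S : word) (s : seq 'cV[R]_2) : Prop :=
  [/\ size s = size S,
      word_map S s`_0 = s`_0 &
      forall i : nat, (i.+1 < size S)%N -> s`_i.+1 = piece (nth symL S i) s`_i].

Definition admissible (S : word) (s : seq 'cV[R]_2) : Prop :=
  forall i : nat, (i < size S)%N -> on_side (nth symL S i) s`_i.

Definition virtual (S : word) (s : seq 'cV[R]_2) : Prop := ~ admissible S s.

Definition off_switching (S : word) (s : seq 'cV[R]_2) : Prop :=
  forall i : nat, (i < size S)%N -> xcoord s`_i != 0.

(* The eigenvalues are the complex ones: the real matrix M_S is mapped to R[i]. *)
Definition stable (S : word) (s : seq 'cV[R]_2) : Prop :=
  [/\ admissible S s, off_switching S s &
      forall lam : R[i],
        eigenvalue (map_mx (real_complex R) (word_mx S)) lam -> `|lam| <= 1].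

End BCNF.

(* Main.v *)
Require Import Defs.
From mathcomp Require Import all_boot all_order all_algebra.
From mathcomp Require Import complex reals.
From mathcomp Require Import ring lra.

Set Implicit Arguments.
Unset Strict Implicit.
Unset Printing Implicit Defensive.

Import Order.TTheory GRing.Theory Num.Theory.
Local Open Scope ring_scope.

(** With [X] and [Y] as in the theorem, [M_X = 1 + N] with [N ^ 2 = 0], so that
    [M_(X^k) = 1 + k N] and [M_(X^k Y)] has trace -2 and determinant 1: both its
    eigenvalues are -1.  Hence the cycle is unique and its multipliers have
    modulus 1.  Its points are polynomial in [k] and in the position: the point
    reached after [j] copies of [X], with [m] copies to go, has an abscissa that
    is affine in [j] and in [m] separately, and every sign condition can be read
    off the coefficients except at the first and third letters of [Y].  At both of
    them the abscissa is [3 (2 - sqrt 2) / 4 - k (3 sqrt 2 - 4) / 4], which is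
    positive for [k <= 7] and negative for [k >= 8]. *)

(** * Affine maps, orbits and sign conditions along a word *)

Section Words.
Variables (R : realType) (xi : bcnf_params R).
Implicit Types (S T : word) (p q : 'cV[R]_2) (P : symbol -> 'cV[R]_2 -> bool).

Lemma word_map_cat S T p :
  word_map xi (S ++ T) p = word_map xi T (word_map xi S p).
Proof. exact: foldl_cat. Qed.

Lemma foldl_word_mx S (M : 'M[R]_2) :
  foldl (fun M J => Amx xi J *m M) M S = word_mx xi S *m M.
Proof.
rewrite /word_mx; elim/last_ind: S => [|S J IH] /=; first by rewrite mul1mx.
by rewrite -!cats1 !foldl_cat /= IH mulmxA.
Qed.

Lemma word_mx_cat S T :
  word_mx xi (S ++ T) = word_mx xi T *m word_mx xi S.
Proof. by rewrite {1}/word_mx foldl_cat foldl_word_mx. Qed.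

(** The translation parts cancel in a difference, so uniqueness of a fixed point becomes a question
    about [word_mx] alone. *)
Lemma word_mapB S p q :
  word_map xi S p - word_map xi S q = word_mx xi S *m (p - q).
Proof.
elim: S p q => [|J S IH] p q /=; first by rewrite mul1mx.
rewrite IH /piece opprD addrACA subrr addr0 -mulmxBr mulmxA; congr (_ *m _).
by rewrite -(cat1s J S) word_mx_cat /word_mx /= mulmx1.
Qed.

Definition orbit_points S p : seq 'cV[R]_2 :=
  mkseq (fun i => word_map xi (take i S) p) (size S).

Lemma word_map_takeS S p i : (i < size S)%N ->
  word_map xi (take i.+1 S) p
  = piece xi (nth symL S i) (word_map xi (take i S) p).
Proof. by move=> iS; rewrite (take_nth symL) // -cats1 word_map_cat. Qed.

Lemma is_cycle_orbit_points S p : (0 < size S)%N ->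
  word_map xi S p = p -> is_cycle xi S (orbit_points S p).
Proof.
move=> Sgt0 fixp.
split; first by rewrite size_mkseq.
  by rewrite nth_mkseq // take0.
by move=> i iS; rewrite !nth_mkseq ?word_map_takeS // ltnW.
Qed.

(** This reduces uniqueness of the cycle to uniqueness of its first point. *)
Lemma is_cycleE S s :
  is_cycle xi S s -> s = orbit_points S s`_0.
Proof.
move=> [sz _ step]; apply: (@eq_from_nth _ 0); rewrite ?size_mkseq // => i.
rewrite sz => iS; rewrite nth_mkseq //; elim: i iS => [|i IH] iS.
  by rewrite take0.
by rewrite word_map_takeS ?(ltnW iS) // -IH ?(ltnW iS) // step.
Qed.

(** Recursive form of a condition on every point of an orbit: it splits over concatenation, so that
    the copies of [X] and the tail [Y] can be checked block by block. *)
Fixpoint along P S p : bool :=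
  if S is J :: T then P J p && along P T (piece xi J p) else true.

Lemma along_cat P S T p :
  along P (S ++ T) p = along P S p && along P T (word_map xi S p).
Proof. by elim: S p => //= J S IH p; rewrite IH andbA. Qed.

Lemma alongP P S p :
  reflect (forall i, (i < size S)%N -> P (nth symL S i) (orbit_points S p)`_i)
          (along P S p).
Proof.
apply: (iffP idP) => [|all_i].
  elim: S p => //= J S IH p /andP[PJ PS] [|i] iS //.
  have := IH _ PS i iS; rewrite !nth_mkseq //.
have {}all_i i : (i < size S)%N -> P (nth symL S i) (word_map xi (take i S) p).
  by move=> iS; have := all_i i iS; rewrite nth_mkseq.
elim: S p all_i => //= J S IH p all_i.
by rewrite (all_i 0%N) //=; apply: IH => i iS; apply: (all_i i.+1).
Qed.

End Words.

(** * Matrices whose only eigenvalue is -1 *)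

Section MinusUnipotent.
Variables (R : realType) (n : nat) (M : 'M[R]_n).
Hypothesis M1sqr0 : (M + 1%:M) *m (M + 1%:M) = 0.

(** On a fixed vector [M + 1] acts as multiplication by 2, so its square multiplies that vector by
    4. *)
Lemma fixed_eq0 (v : 'cV[R]_n) : M *m v = v -> v = 0.
Proof.
move=> Mv; have: (M + 1%:M) *m (M + 1%:M) *m v = 0 by rewrite M1sqr0 mul0mx.
have M1v : (M + 1%:M) *m v = 2 *: v by rewrite mulmxDl mul1mx Mv scaler_nat mulr2n.
rewrite -mulmxA M1v -scalemxAr M1v => /eqP.
by rewrite !scaler_eq0 pnatr_eq0 /= => /eqP.
Qed.

(** Applied to a left eigenvector [v], the hypothesis reads [(lam + 1) ^ 2 *: v = 0]. *)
Lemma eigenvalue_eqN1 (lam : R[i]) :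
  eigenvalue (map_mx (real_complex R) M) lam -> lam = -1.
Proof.
move=> /eigenvalueP[v Mv v_neq0].
have M1v : v *m (map_mx (real_complex R) (M + 1%:M)) = (lam + 1) *: v.
  by rewrite map_mxD map_mx1 mulmxDr mulmx1 Mv scalerDl scale1r.
have: v *m map_mx (real_complex R) ((M + 1%:M) *m (M + 1%:M)) = 0.
  by rewrite M1sqr0 map_mx0 mulmx0.
rewrite map_mxM mulmxA M1v -scalemxAl M1v => /eqP.
by rewrite !scaler_eq0 (negPf v_neq0) orbF orbb addr_eq0 => /eqP.
Qed.

End MinusUnipotent.

(** * Explicit coordinates in dimension two *)

Section TwoByTwo.
Variable R : realType.

Definition pt (x y : R) : 'cV[R]_2 := \col_i (if i == 0 then x else y).

(** Shaped like [compan], so that companion matrices fold into it by conversion. *)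
Definition mx2 (a b c d : R) : 'M[R]_2 :=
  \matrix_(i, j) if i == 0 then if j == 0 then a else b
                 else if j == 0 then c else d.

Lemma mul_mx2 a b c d a' b' c' d' :
  mx2 a b c d *m mx2 a' b' c' d' =
  mx2 (a * a' + b * c') (a * b' + b * d') (c * a' + d * c') (c * b' + d * d').
Proof.
apply/matrixP => i j; rewrite !mxE !big_ord_recl big_ord0 !mxE addr0 /=.
by case: (i == 0); case: (j == 0).
Qed.

Lemma mx2_1 : 1%:M = mx2 1 0 0 1.
Proof. by apply/matrixP => -[[|[]]//= ?] [[|[]]//= ?]; rewrite !mxE. Qed.

Lemma mx2_0 : 0 = mx2 0 0 0 0.
Proof. by apply/matrixP => i j; rewrite !mxE !if_same. Qed.

Lemma add_mx2 a b c d a' b' c' d' :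
  mx2 a b c d + mx2 a' b' c' d' = mx2 (a + a') (b + b') (c + c') (d + d').
Proof.
by apply/matrixP => i j; rewrite !mxE; case: (i == 0); case: (j == 0).
Qed.

Lemma piece_pt (xi : bcnf_params R) J x y :
  piece xi J (pt x y) =
  match J with
  | symL => pt (tauL xi * x + y + mu xi) (- (deltaL xi * x))
  | symR => pt (tauR xi * x + y + mu xi) (- (deltaR xi * x))
  end.
Proof.
case: J; apply/matrixP => i j; rewrite !mxE !big_ord_recl big_ord0 !mxE /=;
  by case: (i == 0); rewrite ?mul1r ?mul0r ?addr0 ?mulNr.
Qed.

End TwoByTwo.

(** * The explicit cycle and the signs of its abscissas *)

Section Family.
Variable R : realType.

Local Notation r2 := (Num.sqrt 2 : R).
Local Notation X := [:: symR; symR; symL].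
Local Notation Y := [:: symL; symR; symL; symL].

Let xi : bcnf_params R :=
  {| tauL := - r2; deltaL := 1; tauR := 1 - r2; deltaR := 1; mu := 1 |}.

Lemma sqr_r2 : r2 * r2 = 2.
Proof. by rewrite -expr2 sqr_sqrtr ?ler0n. Qed.

(* 17/12 is a convergent of the continued fraction of sqrt 2 and 24/17 is 2 divided
   by it.  These bounds decide the critical signs: [curve_x 7 0] is positive iff
   [sqrt 2 < 17/12], and [curve_x 8 0] is negative iff [38/27 < sqrt 2]. *)
Lemma r2_bounds : 24 / 17 < r2 < 17 / 12.
Proof.
have := sqr_r2; have : 0 <= r2 by exact: sqrtr_ge0.
by move=> ? ?; apply/andP; split; nra.
Qed.

Lemma word_mx_X : word_mx xi X = mx2 (3 - r2) (1 - r2) (2 * r2 - 2) (r2 - 1).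
Proof.
rewrite /word_mx /= mulmx1 -![compan _ _]/(mx2 _ _ _ _) !mul_mx2.
by congr mx2; ring: sqr_r2.
Qed.

Lemma word_mx_Y : word_mx xi Y = mx2 (- 1 - r2) 1 (- 2) (r2 - 1).
Proof.
rewrite /word_mx /= mulmx1 -![compan _ _]/(mx2 _ _ _ _) !mul_mx2.
by congr mx2; ring: sqr_r2.
Qed.

Lemma word_mx_Xk k :
  word_mx xi (word_pow X k) =
  mx2 (1 + k%:R * (2 - r2)) (k%:R * (1 - r2))
        (k%:R * (2 * r2 - 2)) (1 + k%:R * (r2 - 2)).
Proof.
elim: k => [|k IH].
  by rewrite /word_mx /= mx2_1; congr mx2; ring.
rewrite -[word_pow X k.+1]/(X ++ word_pow X k).
rewrite word_mx_cat IH word_mx_X mul_mx2 -(natr1 k).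
by congr mx2; ring: sqr_r2.
Qed.

Lemma word_mx_cycle k (M := word_mx xi (word_pow X k ++ Y)) :
  (M + 1%:M) *m (M + 1%:M) = 0.
Proof.
rewrite /M word_mx_cat word_mx_Xk word_mx_Y mx2_1 mx2_0 mul_mx2 add_mx2 mul_mx2.
by congr mx2; ring: sqr_r2.
Qed.

(** The coefficients are forced: [word_map_X] and [word_map_Y] make [curve 0 k] a fixed point for
    every [k], and that fixed point is unique. *)
Definition curve_x (j m : nat) : R :=
  3 / 2 - 3 / 4 * r2 + j%:R * (1 - 3 / 4 * r2) + m%:R * (r2 / 4)
  + j%:R * m%:R * (3 / 2 * r2 - 2).

Definition curve_y (j m : nat) : R :=
  r2 - 3 / 2 + (j%:R + m%:R) * ((r2 - 1) / 2) + j%:R * m%:R * (3 - 2 * r2).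

(* The point of the cycle of [X^(j + m) Y] reached after [j] copies of [X]. *)
Definition curve j m : 'cV[R]_2 := pt (curve_x j m) (curve_y j m).

Lemma word_map_X j m : word_map xi X (curve j m.+1) = curve j.+1 m.
Proof.
rewrite /curve /= !piece_pt /= /curve_x /curve_y -(natr1 m) -(natr1 j).
by congr pt; field: sqr_r2.
Qed.

Lemma word_map_Xk j m : word_map xi (word_pow X m) (curve j m) = curve (j + m) 0.
Proof.
elim: m j => [|m IH] j; first by rewrite addn0.
rewrite -[word_pow X m.+1]/(X ++ word_pow X m) word_map_cat.
by rewrite word_map_X IH addSnnS.
Qed.

Lemma word_map_Y k : word_map xi Y (curve k 0) = curve 0 k.
Proof.
rewrite /curve /= !piece_pt /= /curve_x /curve_y.
by congr pt; field: sqr_r2.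
Qed.

Lemma word_map_cycle k : word_map xi (word_pow X k ++ Y) (curve 0 k) = curve 0 k.
Proof. by rewrite word_map_cat word_map_Xk word_map_Y. Qed.

(** Strict signs give admissibility and avoidance of the switching manifold at once. *)
Definition strict_side J (p : 'cV[R]_2) : bool :=
  match J with symL => xcoord p < 0 | symR => 0 < xcoord p end.

Lemma xcoord_pt (x y : R) : xcoord (pt x y) = x.
Proof. by rewrite /xcoord mxE. Qed.

Lemma along_X j m : along xi strict_side X (curve j m.+1).
Proof.
have /andP[lo hi] := r2_bounds.
have lin n c : 0 <= c -> 0 <= n%:R * c :> R by move=> ?; rewrite mulr_ge0.
have bil c : 0 <= c -> 0 <= j%:R * m%:R * c :> R by move=> ?; rewrite !mulr_ge0.
have c1 : 0 <= 3 / 4 * r2 - 1 by lra.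
have c2 : 0 <= r2 / 4 by lra.
have c3 : 0 <= 3 / 2 * r2 - 2 by lra.
have c4 : 0 <= 5 / 2 - 3 / 2 * r2 by lra.
have c5 : 0 <= (r2 - 1) / 2 by lra.
have c6 : 0 <= 3 - 2 * r2 by lra.
rewrite /curve /= !piece_pt /= !xcoord_pt andbT.
set x0 := curve_x j m.+1; set x1 := _ + _ + 1; set x2 := _ + _ + 1.
(* Expanding [m.+1] turns the negative coefficient of [j] in [curve_x] into a positive one, thanks
   to the product term. Then [x1] is [x0] with [j] and [m] exchanged, and each of [x0], [x1], [- x2]
   has a positive constant term and nonnegative coefficients. *)
have -> : x0 = 3 / 2 - r2 / 2 + j%:R * (3 / 4 * r2 - 1) + m%:R * (r2 / 4)
               + j%:R * m%:R * (3 / 2 * r2 - 2).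
  by rewrite /x0 /curve_x -(natr1 m); field.
have -> : x1 = 3 / 2 - r2 / 2 + m%:R * (3 / 4 * r2 - 1) + j%:R * (r2 / 4)
               + j%:R * m%:R * (3 / 2 * r2 - 2).
  by rewrite /x1 /x0 /curve_x /curve_y -(natr1 m); field: sqr_r2.
have -> : x2 = - (3 / 2 * r2 - 2 + m%:R * (5 / 2 - 3 / 2 * r2)
                  + j%:R * ((r2 - 1) / 2) + j%:R * m%:R * (3 - 2 * r2)).
  by rewrite /x2 /x1 /x0 /curve_x /curve_y -(natr1 m); field: sqr_r2.
have := (lin j _ c1, lin m _ c2, bil _ c3, lin m _ c1, lin j _ c2).
have := (lin m _ c4, lin j _ c5, bil _ c6).
move=> [[? ?] ?] [[[[? ?] ?] ?] ?].
by apply/and3P; split; lra.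
Qed.

Lemma along_Xk j m : along xi strict_side (word_pow X m) (curve j m).
Proof.
elim: m j => // m IH j.
rewrite -[word_pow X m.+1]/(X ++ word_pow X m) along_cat along_X.
by rewrite word_map_X IH.
Qed.

Lemma curve_xk0 k : curve_x k 0 = 3 / 2 - 3 / 4 * r2 - k%:R * (3 / 4 * r2 - 1).
Proof. by rewrite /curve_x; field. Qed.

(** The abscissa decreases with [k], so [k = 7] is the worst case. Its sign contradicts the first
    letter of [Y]. *)
Lemma curve_x_gt0 k : (k < 8)%N -> 0 < curve_x k 0.
Proof.
have /andP[lo hi] := r2_bounds; rewrite ltnS -(ler_nat R) curve_xk0 => k7.
have c : 0 <= 3 / 4 * r2 - 1 by lra.
by have := ler_wpM2r c k7; lra.
Qed.

Lemma along_Y k : (8 <= k)%N -> along xi strict_side Y (curve k 0).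
Proof.
have /andP[lo hi] := r2_bounds; rewrite -(ler_nat R) => k8.
have c1 : 0 <= 3 / 4 * r2 - 1 by lra.
have c2 : 0 <= 1 - r2 / 2 by lra.
have c3 : 0 <= (r2 - 1) / 2 by lra.
rewrite /curve /= !piece_pt /= !xcoord_pt andbT.
set x0 := curve_x k 0; set x1 := _ + _ + 1; set x2 := _ + _ + 1.
set x3 := _ + _ + 1.
have x0E : x0 = 3 / 2 - 3 / 4 * r2 - k%:R * (3 / 4 * r2 - 1) := curve_xk0 k.
have x1E : x1 = (1 + k%:R) * (1 - r2 / 2).
  by rewrite /x1 x0E /curve_y; field: sqr_r2.
have x2E : x2 = x0 by rewrite /x2 x1E x0E; field: sqr_r2.
have x3E : x3 = 3 / 2 - r2 - k%:R * ((r2 - 1) / 2).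
  by rewrite /x3 x2E x1E x0E; field: sqr_r2.
rewrite x2E x0E x1E x3E.
(* Each abscissa is monotone in [k], in the direction of its required sign, so comparison with
   [k = 8] suffices. *)
have := (ler_wpM2r c1 k8, ler_wpM2r c2 k8, ler_wpM2r c3 k8).
by move=> [[? ?] ?]; apply/and4P; split; lra.
Qed.

End Family.

Unset Implicit Arguments.

Theorem proposition4p4 (R : realType) (k : nat) :
  let X : word := [:: symR; symR; symL] in
  let Y : word := [:: symL; symR; symL; symL] in
  let S : word := word_pow X k ++ Y in
  let xi : bcnf_params R :=
    {| tauL := - Num.sqrt 2; deltaL := 1;
       tauR := 1 - Num.sqrt 2; deltaR := 1; mu := 1 |} in
  (1 <= k)%N ->
  (exists! s : seq 'cV[R]_2, is_cycle xi S s) /\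
  (forall s : seq 'cV[R]_2, is_cycle xi S s ->
     ((8 <= k)%N -> admissible S s /\ stable xi S s) /\
     ((k < 8)%N -> virtual S s)).
Proof.
move=> X Y S xi _; set s := orbit_points xi S (curve R 0 k).
have uniq_cycle t : is_cycle xi S t -> s = t.
  move=> ct; rewrite (is_cycleE ct) /s; congr (orbit_points xi S _).
  (* The difference of two fixed points of the affine map is fixed by its matrix part, hence
     zero. *)
  apply/esym/eqP; rewrite -subr_eq0; apply/eqP.
  apply: (fixed_eq0 (word_mx_cycle R k)).
  by rewrite -word_mapB word_map_cycle; case: ct => _ ->.
have cs : is_cycle xi S s.
  apply: is_cycle_orbit_points; last exact: word_map_cycle.
  by rewrite size_cat addnS.
split; first by exists s; split.
move=> _ /uniq_cycle <-; split => [k8|k_lt8 adm].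
  have strict : along xi (@strict_side R) S (curve R 0 k).
    by rewrite along_cat along_Xk word_map_Xk along_Y.
  have {}strict i (iS : (i < size S)%N) := alongP _ _ _ _ strict i iS.
  have adm : admissible S s.
    by move=> i /strict; rewrite /s; case: (nth _ _ _) => /ltW.
  split=> //; split=> //.
    move=> i /strict; rewrite /s /strict_side.
    by case: (nth _ _ _) => ?; [rewrite lt_eqF | rewrite gt_eqF].
  by move=> lam /(eigenvalue_eqN1 (word_mx_cycle R k)) ->; rewrite normrN1.
(* Admissibility fails at [curve k 0], the point where [Y] starts: its letter is [symL] but its
   abscissa is positive. *)
have : along xi (@on_side R) S (curve R 0 k) by apply/alongP.
by rewrite along_cat word_map_Xk /= xcoord_pt leNgt curve_x_gt0 // andbF.
Qed.
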